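(* Let $c>0$ and let $\phi:\mathbb{R}\to\mathbb{R}$ be a continuous solitary solution (with $\phi(x)\to 0$ as $|x|\to\infty$) to the steady Degasperis-Procesi equation $$\frac{\phi(x)}{3}\,(2c-\phi(x)) = (K*\phi^2)(x),\qquad x\in\mathbb{R},\qquad K(x)=\tfrac12 e^{-|x|},$$ which is highest, i.e. $\sup_{x\in\mathbb{R}}\phi(x)=c$. Assume that the local structure of $\phi$ at a crest of height $c$ is as follows: for every $x_0\in\mathbb{R}$ with $\phi(x_0)=c$ there are $\alpha\in(0,1]$ and constants $C_1,C_2>0$ such that $$C_1|x-x_0|^{\alpha}\le c-\phi(x)\le C_2|x-x_0|^{\alpha}$$ for all $x$ sufficiently close to $x_0$. Then there exists a finite $\lambda_0\in\mathbb{R}$ such that $\phi$ is symmetric about $x=\lambda_0$ (i.e. $\phi(x)=\phi(2\lambda_0-x)$ for all $x\in\mathbb{R}$), the crest of $\phi$ is located at $x=\lambda_0$, and $\phi$ is strictly monotonic on each side of the symmetric axis $x=\lambda_0$.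
   Context: $K(x)=\frac12 e^{-|x|}$ is the convolution kernel of $L=(1-\partial_x^2)^{-1}$, so $Lf=K*f$ with $(K*f)(x)=\int_{\mathbb{R}}K(x-y)f(y)\,\mathrm{d}y$. The constant $c>0$ is the wave speed. A crest is a point where $\phi$ attains a (local) maximum. *)

(* Defs.v *)
From Stdlib Require Import Reals Lra.
From Coquelicot Require Import Coquelicot.
Open Scope R_scope.

Definition K (x : R) : R := / 2 * exp (- Rabs x).

(* The integral over the real line is an improper Riemann integral.  RInt_gen
   is total, with a junk value on divergent integrals; K decays exponentially,
   so the integral converges for every bounded continuous g. *)
Definition convolution (f g : R -> R) (x : R) : R :=
  RInt_gen (fun y => f (x - y) * g y)
    (Rbar_locally m_infty) (Rbar_locally p_infty).

(* Stdlib has Rpower 0 a = 1; here 0 is sent to 0, the usual convention for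
   0^a with a > 0. *)
Definition rpow (t a : R) : R :=
  if Req_EM_T t 0 then 0 else Rpower t a.

Definition solves_steady_DP (c : R) (phi : R -> R) : Prop :=
  forall x : R,
    phi x / 3 * (2 * c - phi x) = convolution K (fun y => (phi y) ^ 2) x.

Definition continuous_solitary_solution (c : R) (phi : R -> R) : Prop :=
  (forall x : R, continuous phi x) /\
  is_lim phi p_infty 0 /\
  is_lim phi m_infty 0 /\
  solves_steady_DP c phi.

Definition is_highest (c : R) (phi : R -> R) : Prop :=
  is_lub (fun v : R => exists x : R, v = phi x) c.

Definition crest (phi : R -> R) (x0 : R) : Prop :=
  locally x0 (fun x => phi x <= phi x0).

Definition symmetric_about (phi : R -> R) (l : R) : Prop :=
  forall x : R, phi x = phi (2 * l - x).

(* Main.v *)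
(** With [w := K * phi^2], the equation [w - w'' = phi^2] and
    [3 w = phi (2 c - phi)] turn into an autonomous second-order equation for [w].
    As [|w'| <= w], both tend to [0] at infinity, and the first integral reads
    [w'^2 = 4/9 phi^2 (c - phi)^2].  Since [phi > 0], the zeros of [w'] are exactly
    the points where [phi = c]; a minimum of [phi] between two such points would be
    another zero of [w'], so there is only one, and away from it [phi' = phi] or
    [phi' = - phi].  Hence [phi x = c * exp (- |x - lambda0|)]. *)

Require Import Defs.
From Stdlib Require Import Reals Lra.
From Coquelicot Require Import Coquelicot.
Open Scope R_scope.

(* [auto_derive] leaves eta-expanded terms [Derive (fun t => f t) x]. *)
Ltac rewrite_Derive H :=
  lazymatch type of H with
  | is_derive ?f ?x ?l =>
      replace (Derive (fun t => f t) x) with l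
        by (symmetry; apply is_derive_unique, H)
  end.

(** * Monotonicity from derivatives, attained maxima and a product rule *)

Lemma is_derive_continuity_pt (f : R -> R) (x l : R) :
  is_derive f x l -> continuity_pt f x.
Proof.
  intros H. apply continuity_pt_filterlim.
  apply (ex_derive_continuous (K := R_AbsRing) (V := R_NormedModule)).
  now exists l.
Qed.

Lemma is_derive_nonneg_incr (f df : R -> R) (a b : R) :
  (forall x, a <= x <= b -> is_derive f x (df x)) ->
  (forall x, a <= x <= b -> 0 <= df x) -> a <= b -> f a <= f b.
Proof.
  intros Hd Hp Hab.
  destruct (MVT_gen f a b df) as [z [Hz E]];
    rewrite ?Rmin_left, ?Rmax_right in * by lra.
  - intros x Hx. apply Hd; lra.
  - intros x Hx. apply (is_derive_continuity_pt f x (df x)), Hd; lra.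
  - specialize (Hp z Hz). nra.
Qed.

Lemma is_derive_nonpos_decr (f df : R -> R) (a b : R) :
  (forall x, a <= x <= b -> is_derive f x (df x)) ->
  (forall x, a <= x <= b -> df x <= 0) -> a <= b -> f b <= f a.
Proof.
  intros Hd Hp Hab.
  apply Ropp_le_cancel.
  apply (is_derive_nonneg_incr (fun x => - f x) (fun x => - df x)); trivial.
  - intros x Hx. apply (is_derive_opp f), Hd, Hx.
  - intros x Hx. specialize (Hp x Hx). lra.
Qed.

(** Differentiability is required only inside the interval, because an endpoint may be the peak,
    where the wave has a kink. *)
Lemma is_derive_0_open_interval_eq (f : R -> R) (a b : R) :
  (forall x, a < x < b -> is_derive f x 0) ->
  (forall x, a <= x <= b -> continuity_pt f x) -> a <= b -> f a = f b.
Proof.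
  intros Hd Hc Hab.
  destruct (MVT_gen f a b (fun _ => 0)) as [z [Hz E]];
    rewrite ?Rmin_left, ?Rmax_right in * by lra; trivial.
  lra.
Qed.

Lemma is_lim_0_p_infty_bound (f : R -> R) (eps : R) :
  is_lim f p_infty 0 -> 0 < eps -> exists A, forall x, A < x -> Rabs (f x) < eps.
Proof.
  intros H He. apply is_lim_spec in H.
  destruct (H (mkposreal eps He)) as [A HA]. exists A. intros x Hx.
  specialize (HA x Hx). simpl in HA. now rewrite Rminus_0_r in HA.
Qed.

Lemma is_lim_0_m_infty_bound (f : R -> R) (eps : R) :
  is_lim f m_infty 0 -> 0 < eps -> exists A, forall x, x < A -> Rabs (f x) < eps.
Proof.
  intros H He. apply is_lim_spec in H.
  destruct (H (mkposreal eps He)) as [A HA]. exists A. intros x Hx.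
  specialize (HA x Hx). simpl in HA. now rewrite Rminus_0_r in HA.
Qed.

(** Outside a compact interval containing [a], [f] stays below the positive value [f a], so the
    maximum over that interval is global. *)
Lemma vanishing_at_infinity_attains_max (f : R -> R) (a : R) :
  (forall x, continuity_pt f x) -> is_lim f p_infty 0 -> is_lim f m_infty 0 ->
  0 < f a -> exists x0, forall x, f x <= f x0.
Proof.
  intros Hc Hp Hm Ha.
  destruct (is_lim_0_p_infty_bound f (f a) Hp Ha) as [A HA].
  destruct (is_lim_0_m_infty_bound f (f a) Hm Ha) as [B HB].
  pose proof (Rmax_l A a) as HAl. pose proof (Rmax_r A a) as HAr.
  pose proof (Rmin_l B a) as HBl. pose proof (Rmin_r B a) as HBr.
  destruct (continuity_ab_maj f (Rmin B a) (Rmax A a)) as [x0 [Hx0 _]].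
  - lra.
  - intros x _. apply Hc.
  - exists x0. intros x.
    assert (Ha0 : f a <= f x0) by (apply Hx0; lra).
    destruct (Rlt_le_dec (Rmax A a) x) as [Hx|Hx].
    + assert (H := HA x ltac:(lra)). apply Rabs_def2 in H. lra.
    + destruct (Rlt_le_dec x (Rmin B a)) as [Hx'|Hx'].
      * assert (H := HB x ltac:(lra)). apply Rabs_def2 in H. lra.
      * apply Hx0; lra.
Qed.

(** As [f x = 0], the difference quotient is [f (x + h) / h * g (x + h)], so continuity of [g] can
    stand in for differentiability. This serves at points of height [c], with [g] being
    [c - phi]. *)
Lemma is_derive_mult_vanishing (f g : R -> R) (x d : R) :
  is_derive f x d -> f x = 0 -> continuity_pt g x ->
  is_derive (fun y => f y * g y) x (d * g x).
Proof.
  intros Hf H0 Hg. apply is_derive_Reals.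
  apply is_derive_Reals in Hf.
  intros eps He.
  set (G := Rabs (g x) + 1). set (D := Rabs d + 1).
  assert (HG : 0 < G) by (unfold G; pose proof (Rabs_pos (g x)); lra).
  assert (HD : 0 < D) by (unfold D; pose proof (Rabs_pos d); lra).
  (* Each of the two error terms gets [eps / 2]; the cap [1] in [e2] keeps [|g (x + h)|] below
     [G]. *)
  set (e1 := eps / (2 * G)). set (e2 := Rmin 1 (eps / (2 * D))).
  assert (He1 : 0 < e1) by (apply Rdiv_lt_0_compat; lra).
  assert (He2 : 0 < e2) by (apply Rmin_pos; [lra | apply Rdiv_lt_0_compat; lra]).
  destruct (Hf e1 He1) as [d1 H1].
  destruct (Hg e2 He2) as [d2 [Hd2 H2]].
  exists (mkposreal (Rmin d1 d2) (Rmin_pos _ _ (cond_pos d1) Hd2)).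
  intros h Hh Hhd. simpl in Hhd.
  specialize (H1 h Hh (Rlt_le_trans _ _ _ Hhd (Rmin_l _ _))).
  assert (Hgh : Rabs (g (x + h) - g x) < e2).
  { apply (H2 (x + h)). split.
    - split; [exact I | lra].
    - simpl. unfold Rdist. replace (x + h - x) with h by ring.
      exact (Rlt_le_trans _ _ _ Hhd (Rmin_r _ _)). }
  rewrite H0 in *. rewrite Rminus_0_r in H1.
  replace ((f (x + h) * g (x + h) - 0 * g x) / h - d * g x)
    with ((f (x + h) / h - d) * g (x + h) + d * (g (x + h) - g x))
    by (field; assumption).
  eapply Rle_lt_trans; [apply Rabs_triang|].
  rewrite !Rabs_mult.
  assert (HgG : Rabs (g (x + h)) <= G).
  { unfold G. replace (g (x + h)) with ((g (x + h) - g x) + g x) by ring.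
    eapply Rle_trans; [apply Rabs_triang|].
    assert (e2 <= 1) by apply Rmin_l. lra. }
  assert (Ha : Rabs (f (x + h) / h - d) * Rabs (g (x + h)) <= eps / 2).
  { replace (eps / 2) with (e1 * G) by (unfold e1; field; lra).
    apply Rmult_le_compat; try apply Rabs_pos; lra. }
  assert (Hb : Rabs d * Rabs (g (x + h) - g x) < eps / 2).
  { replace (eps / 2) with (D * (eps / (2 * D))) by (field; lra).
    assert (e2 <= eps / (2 * D)) by apply Rmin_r.
    apply Rle_lt_trans with (Rabs d * (eps / (2 * D))).
    - apply Rmult_le_compat_l; [apply Rabs_pos | lra].
    - apply Rmult_lt_compat_r; [lra | unfold D; lra]. }
  lra.
Qed.

(** * Convolution with the exponential kernel *)

(** [Q x] is the integral of [exp (- y) * g y] over [[x, +oo[], obtained as [l - B x] with [B] a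
    primitive and [l] its supremum: [B] is monotone and bounded, hence converges to [l]. *)
Lemma exp_tail_integral (g : R -> R) (M : R) :
  (forall x, continuous g x) -> (forall x, 0 <= g x <= M) ->
  exists Q : R -> R,
    (forall x, is_derive Q x (- (exp (- x) * g x))) /\
    (forall x, 0 <= Q x) /\ is_lim Q p_infty 0.
Proof.
  intros Hg HM.
  set (f := fun y => exp (- y) * g y).
  assert (Hf : forall x, continuous f x).
  { intros x. apply (continuous_mult (fun y => exp (- y)) g); [|apply Hg].
    apply (ex_derive_continuous (K := R_AbsRing) (V := R_NormedModule)).
    auto_derive; trivial. }
  set (B := RInt f 0).
  assert (HB : forall x, is_derive B x (f x)).
  { intros x. apply (is_derive_RInt (V := R_NormedModule) f B 0 x); [|apply Hf].
    apply filter_forall. intros y. apply (RInt_correct (V := R_CompleteNormedModule)), ex_RInt_continuous.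
    intros z _. apply Hf. }
  assert (Bincr : forall x y, x <= y -> B x <= B y).
  { intros x y. apply (is_derive_nonneg_incr B f).
    - intros z _. apply HB.
    - intros z _. unfold f. pose proof (exp_pos (- z)). specialize (HM z). nra. }
  assert (B0 : B 0 = 0) by (apply (RInt_point (V := R_CompleteNormedModule))).
  assert (Bbd : forall x, B x <= M).
  { intros x. destruct (Rle_dec 0 x) as [Hx|Hx].
    (* As [g <= M], adding [M * exp (- x)] to [B] gives a nonincreasing function, whence
       [B x <= M]. *)
    - assert (H : B x + M * exp (- x) <= B 0 + M * exp (- 0)).
      { apply (is_derive_nonpos_decr (fun y => B y + M * exp (- y))
                 (fun y => f y - M * exp (- y))); trivial.
        - intros z _. auto_derive.
          + now exists (f z).
          + rewrite_Derive (HB z). ring.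
        - intros z _. unfold f. pose proof (exp_pos (- z)). specialize (HM z). nra. }
      rewrite Ropp_0, exp_0, B0 in H.
      pose proof (exp_pos (- x)). specialize (HM 0). nra.
    - assert (B x <= B 0) by (apply Bincr; lra). specialize (HM 0). lra. }
  destruct (completeness (fun v => exists x, v = B x)) as [l [Hl1 Hl2]].
  - exists M. intros v [x ->]. apply Bbd.
  - exists (B 0). now exists 0.
  - assert (Bl : forall x, B x <= l) by (intros x; apply Hl1; now exists x).
    exists (fun x => l - B x). split; [|split].
    + intros x. auto_derive.
      * now exists (f x).
      * rewrite_Derive (HB x). unfold f. ring.
    + intros x. specialize (Bl x). lra.
    + apply is_lim_spec. intros eps.
      destruct (Classical_Prop.classic (exists x, l - eps < B x)) as [[x1 Hx1]|Hn].
      * exists x1. intros x Hx. specialize (Bl x).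
        assert (B x1 <= B x) by (apply Bincr; lra).
        apply Rabs_def1; lra.
      * exfalso. assert (l <= l - eps).
        { apply Hl2. intros v [x ->]. apply Rnot_lt_le. intros H. apply Hn.
          now exists x. }
        pose proof (cond_pos eps). lra.
Qed.

(* [P] and [Q] are the integrals of [exp y * g y] over ]-oo, x] and of
   [exp (- y) * g y] over [x, +oo[. *)
Lemma convolution_K_decomposition (g : R -> R) (M : R) :
  (forall x, continuous g x) -> (forall x, 0 <= g x <= M) ->
  exists P Q : R -> R,
    (forall x, is_derive P x (exp x * g x)) /\
    (forall x, is_derive Q x (- (exp (- x) * g x))) /\
    (forall x, 0 <= P x) /\ (forall x, 0 <= Q x) /\
    (forall x, convolution K g x = / 2 * (exp (- x) * P x + exp x * Q x)).
Proof.
  intros Hg HM.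
  destruct (exp_tail_integral g M Hg HM) as [Q [HQ [HQ0 HQl]]].
  (* The substitution [y -> - y] turns the integral over []-oo, x]] into a tail of the reflected
     function. *)
  destruct (exp_tail_integral (fun x => g (- x)) M) as [T [HT [HT0 HTl]]].
  { intros x. apply (continuous_comp Ropp g); [|apply Hg].
    apply (continuous_opp (fun y : R => y)), continuous_id. }
  { intros x. apply HM. }
  set (P := fun x => T (- x)).
  assert (HP : forall x, is_derive P x (exp x * g x)).
  { intros x. unfold P. auto_derive.
    - eexists. apply HT.
    - rewrite_Derive (HT (- x)).
      rewrite !Ropp_involutive. ring. }
  exists P, Q. do 4 (split; [assumption || (intros x; apply HT0)|]).
  intros x.
  assert (Cexp : forall y, continuous exp y).
  { intros y. apply (ex_derive_continuous (K := R_AbsRing) (V := R_NormedModule)).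
    auto_derive; trivial. }
  assert (Copp : forall y, continuous (fun z => exp (- z)) y).
  { intros y. apply (ex_derive_continuous (K := R_AbsRing) (V := R_NormedModule)).
    auto_derive; trivial. }
  (* Splitting at the kink [y = x] fixes the sign of [x - y], so the kernel factors into an
     exponential in [x] times one in [y]. *)
  assert (HI : forall a b, a < x -> x < b ->
    is_RInt (fun y => K (x - y) * g y) a b
      (/ 2 * exp (- x) * (P x - P a) + / 2 * exp x * (Q x - Q b))).
  { intros a b Ha Hb.
    apply (is_RInt_Chasles (V := R_NormedModule) _ a x b).
    - apply is_RInt_ext with (fun y => / 2 * exp (- x) * (exp y * g y)).
      + rewrite Rmin_left, Rmax_right by lra. intros y Hy.
        unfold K. rewrite Rabs_pos_eq by lra.
        replace (- (x - y)) with (- x + y) by ring. rewrite exp_plus.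
        simpl. ring.
      + apply (is_RInt_scal (V := R_NormedModule)).
        apply (is_RInt_derive (V := R_CompleteNormedModule) P).
        * intros y _. apply HP.
        * intros y _. apply (continuous_mult exp g); trivial.
    - apply is_RInt_ext with (fun y => / 2 * exp x * (exp (- y) * g y)).
      + rewrite Rmin_left, Rmax_right by lra. intros y Hy.
        unfold K. rewrite Rabs_left1 by lra.
        replace (- - (x - y)) with (x + - y) by ring. rewrite exp_plus.
        simpl. ring.
      + apply (is_RInt_scal (V := R_NormedModule)).
        replace (Q x - Q b) with (minus (- Q b) (- Q x))
          by (unfold minus, plus, opp; simpl; ring).
        apply (is_RInt_derive (V := R_CompleteNormedModule) (fun y => - Q y)).
        * intros y _. rewrite <- (Ropp_involutive (exp (- y) * g y)).
          apply (is_derive_opp Q), HQ.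
        * intros y _. apply (continuous_mult (fun y => exp (- y)) g); trivial. }
  unfold convolution.
  apply (is_RInt_gen_unique (V := R_CompleteNormedModule)); try typeclasses eauto.
  intros S [eps HS].
  (* The truncated integral misses the value by [/ 2 * exp (- x) * P a + / 2 * exp x * Q b], which
     is below [eps] once both tails are below [eps / k]. *)
  set (k := / 2 * exp (- x) + / 2 * exp x).
  assert (Hk : 0 < k)
    by (unfold k; pose proof (exp_pos x); pose proof (exp_pos (- x)); lra).
  assert (He : 0 < eps / k) by (apply Rdiv_lt_0_compat; [apply cond_pos | trivial]).
  destruct (is_lim_0_p_infty_bound Q _ HQl He) as [A HA].
  destruct (is_lim_0_p_infty_bound T _ HTl He) as [B HB].
  exists (fun a => a < Rmin x (- B)) (fun b => Rmax x A < b).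
  - now exists (Rmin x (- B)).
  - now exists (Rmax x A).
  - intros a b Ha Hb.
    pose proof (Rmin_l x (- B)). pose proof (Rmin_r x (- B)).
    pose proof (Rmax_l x A). pose proof (Rmax_r x A).
    eexists. split; [apply HI; simpl; lra|].
    apply HS. unfold ball. simpl. unfold AbsRing_ball, minus, plus, opp, abs. simpl.
    assert (H3 : Rabs (P a) < eps / k) by (apply HB; lra).
    assert (H4 : Rabs (Q b) < eps / k) by (apply HA; lra).
    apply Rabs_def2 in H3. apply Rabs_def2 in H4.
    assert (Ek : eps = eps / k * k :> R) by (field; lra).
    pose proof (exp_pos x). pose proof (exp_pos (- x)).
    set (e := eps / k) in *. rewrite Ek. unfold k.
    apply Rabs_def1; nra.
Qed.

(** * The exponential profile on both sides of the crest *)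

(** Since [3 w = c^2 - (c - phi)^2], [w] is smaller right of [x0] than at [x0], so [v] is negative
    somewhere; having no zero there, it is negative throughout. The negative root of the first
    integral gives [phi' = - phi], so [phi * exp] is constant, up to [x0] by continuity. *)
Lemma peakon_right_half (c x0 : R) (phi w v : R -> R) :
  (forall x, continuity_pt phi x) ->
  (forall x, is_derive w x (v x)) -> (forall x, continuity_pt v x) ->
  (forall x, 3 * w x = phi x * (2 * c - phi x)) ->
  (forall x, v x ^ 2 = 4 / 9 * (phi x ^ 2 * (c - phi x) ^ 2)) ->
  (forall x, phi x < c -> is_derive phi x (3 * v x / (2 * (c - phi x)))) ->
  (forall x, 0 < phi x) ->
  phi x0 = c -> (forall x, x0 < x -> phi x < c) ->
  forall x, x0 <= x -> phi x = c * exp (x0 - x).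
Proof.
  intros Cphi Dw Cv Hw Hv Dphi Hpos H0 Hlt.
  assert (v0 : v x0 = 0).
  { specialize (Hv x0). rewrite H0 in Hv.
    destruct (Req_dec (v x0) 0); [trivial | nra]. }
  assert (vne : forall x, x0 < x -> v x <> 0).
  { intros x Hx E. specialize (Hv x). rewrite E in Hv.
    specialize (Hpos x). specialize (Hlt x Hx).
    assert (0 < phi x * (c - phi x)) by nra. nra. }
  assert (vneg : forall x, x0 < x -> v x < 0).
  { intros x1 Hx1.
    destruct (MVT_gen w x0 x1 v) as [z [Hz E]];
      rewrite ?Rmin_left, ?Rmax_right in * by lra.
    - intros x _. apply Dw.
    - intros x _. apply (is_derive_continuity_pt w x (v x)), Dw.
    - assert (w x1 < w x0).
      { pose proof (Hw x0) as E0. pose proof (Hw x1) as E1. rewrite H0 in E0.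
        specialize (Hlt x1 Hx1). nra. }
      assert (Hvz : v z < 0) by nra.
      destruct (Rlt_le_dec (v x1) 0) as [|Hge]; [trivial|exfalso].
      destruct (IVT_cor v z x1) as [y [Hy Ey]]; try lra; try nra.
      + exact Cv.
      (* The mean value point is only known to lie in the closed interval; [v x0 = 0] excludes the
         endpoint. *)
      + assert (z <> x0) by (intros ->; lra).
        apply (vne y); [lra | trivial]. }
  intros x Hx.
  assert (Dphi' : forall y, x0 < y -> is_derive phi y (- phi y)).
  { intros y Hy. replace (- phi y) with (3 * v y / (2 * (c - phi y))).
    - apply Dphi, Hlt, Hy.
    - specialize (Hlt y Hy). specialize (Hpos y).
      assert (v y = - (2 / 3 * (phi y * (c - phi y)))) as ->.
      { specialize (Hv y). specialize (vneg y Hy).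
        assert (0 < phi y * (c - phi y)) by nra. nra. }
      field. lra. }
  assert (E : phi x0 * exp x0 = phi x * exp x).
  { apply (is_derive_0_open_interval_eq (fun y => phi y * exp y)); trivial.
    - intros y [Hy _]. auto_derive.
      + eexists; apply Dphi', Hy.
      + rewrite_Derive (Dphi' y Hy). ring.
    - intros y _. apply continuity_pt_mult; [apply Cphi|].
      apply derivable_continuous_pt, derivable_pt_exp. }
  unfold Rminus. rewrite exp_plus, exp_Ropp.
  rewrite H0 in E. rewrite <- Rmult_assoc, E. field.
  apply Rgt_not_eq, exp_pos.
Qed.

Lemma is_derive_reflect (f : R -> R) (x l : R) :
  is_derive f (- x) l -> is_derive (fun y => f (- y)) x (- l).
Proof.
  intros H. auto_derive.
  - now exists l.
  - rewrite_Derive H. ring.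
Qed.

Lemma continuity_pt_reflect (f : R -> R) (x : R) :
  continuity_pt f (- x) -> continuity_pt (fun y => f (- y)) x.
Proof.
  intros H. apply (continuity_pt_comp Ropp f); trivial.
  apply continuity_pt_opp, derivable_continuous_pt, derivable_pt_id.
Qed.

(** The left half is the right half of the reflected wave, for which [v] changes sign. *)
Lemma peakon_profile (c x0 : R) (phi w v : R -> R) :
  (forall x, continuity_pt phi x) ->
  (forall x, is_derive w x (v x)) -> (forall x, continuity_pt v x) ->
  (forall x, 3 * w x = phi x * (2 * c - phi x)) ->
  (forall x, v x ^ 2 = 4 / 9 * (phi x ^ 2 * (c - phi x) ^ 2)) ->
  (forall x, phi x < c -> is_derive phi x (3 * v x / (2 * (c - phi x)))) ->
  (forall x, 0 < phi x) ->
  phi x0 = c -> (forall x, x <> x0 -> phi x < c) ->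
  forall x, phi x = c * exp (- Rabs (x - x0)).
Proof.
  intros Cphi Dw Cv Hw Hv Dphi Hpos H0 Hlt x.
  destruct (Rle_dec x0 x) as [Hx|Hx].
  - rewrite Rabs_pos_eq by lra. replace (- (x - x0)) with (x0 - x) by ring.
    apply (peakon_right_half c x0 phi w v); trivial.
    intros y Hy. apply Hlt. lra.
  - rewrite Rabs_left by lra. rewrite Ropp_involutive.
    rewrite <- (Ropp_involutive x) at 1.
    replace (x - x0) with (- x0 - - x) by ring.
    apply (peakon_right_half c (- x0) (fun y => phi (- y)) (fun y => w (- y))
             (fun y => - v (- y))).
    + intros y. apply continuity_pt_reflect, Cphi.
    + intros y. apply is_derive_reflect, Dw.
    + intros y. apply continuity_pt_opp, continuity_pt_reflect, Cv.
    + intros y. apply Hw.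
    + intros y. rewrite <- Hv. ring.
    + intros y Hy.
      replace (3 * - v (- y) / (2 * (c - phi (- y))))
        with (- (3 * v (- y) / (2 * (c - phi (- y))))) by (field; lra).
      apply is_derive_reflect, Dphi, Hy.
    + intros y. apply Hpos.
    + now rewrite Ropp_involutive.
    + intros y Hy. apply Hlt. lra.
    + lra.
Qed.

(** * Reduction to an ordinary differential equation and its first integral *)

(** [w] is half the sum, and [v = w'] half the difference, of the same two nonnegative one-sided
    terms; hence [|v| <= w]. *)
Lemma steady_DP_reduction (c : R) (phi : R -> R) :
  0 < c -> continuous_solitary_solution c phi -> (forall x, phi x <= c) ->
  (exists x, phi x = c) ->
  exists w v : R -> R,
    (forall x, is_derive w x (v x)) /\
    (forall x, is_derive v x (w x - phi x ^ 2)) /\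
    (forall x, 3 * w x = phi x * (2 * c - phi x)) /\
    (forall x, Rabs (v x) <= w x) /\ (forall x, 0 < phi x).
Proof.
  intros hc [Cphi [Lp [Lm Heq]]] Hle [x0 H0].
  (* The bound [phi <= c] says nothing from below, so [phi^2] is bounded through the maximum of
     [|phi|]. *)
  destruct (vanishing_at_infinity_attains_max (fun x => Rabs (phi x)) x0)
    as [xm Hxm].
  { intros x. apply (continuity_pt_comp phi Rabs).
    - apply continuity_pt_filterlim, Cphi.
    - apply Rcontinuity_abs. }
  { rewrite <- Rabs_R0. now apply (is_lim_Rabs phi p_infty 0). }
  { rewrite <- Rabs_R0. now apply (is_lim_Rabs phi m_infty 0). }
  { rewrite H0, Rabs_pos_eq; lra. }
  destruct (convolution_K_decomposition (fun y => phi y ^ 2) (Rabs (phi xm) ^ 2))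
    as [P [Q [HP [HQ [HP0 [HQ0 HC]]]]]].
  { intros x. apply (continuous_comp phi (fun t => t ^ 2)); trivial.
    apply (ex_derive_continuous (K := R_AbsRing) (V := R_NormedModule)).
    auto_derive; trivial. }
  { intros x. split; [apply pow2_ge_0|].
    rewrite <- (pow2_abs (phi x)). apply pow_incr. split; [apply Rabs_pos | apply Hxm]. }
  set (w := fun x => / 2 * (exp (- x) * P x + exp x * Q x)).
  set (v := fun x => / 2 * (exp x * Q x - exp (- x) * P x)).
  assert (Dw : forall x, is_derive w x (v x)).
  { intros x. unfold w, v. auto_derive.
    - repeat split; eexists; [apply HP | apply HQ].
    - rewrite_Derive (HP x); rewrite_Derive (HQ x).
      ring. }
  assert (Dv : forall x, is_derive v x (w x - phi x ^ 2)).
  { intros x. unfold w, v. auto_derive.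
    - repeat split; eexists; [apply HQ | apply HP].
    - rewrite_Derive (HP x); rewrite_Derive (HQ x).
      rewrite exp_Ropp. field. apply Rgt_not_eq, exp_pos. }
  assert (Hw : forall x, 3 * w x = phi x * (2 * c - phi x)).
  { intros x. unfold w. rewrite <- HC, <- (Heq x). field. }
  assert (Hvw : forall x, Rabs (v x) <= w x).
  { intros x. unfold v, w. pose proof (exp_pos x). pose proof (exp_pos (- x)).
    specialize (HP0 x). specialize (HQ0 x). apply Rabs_le. split; nra. }
  exists w, v. do 4 (split; [assumption|]).
  assert (w0 : 0 < w x0).
  { specialize (Hw x0). rewrite H0 in Hw. nra. }
  intros x.
  (* [|w'| <= w] makes [exp x * w x] nondecreasing and [exp (- x) * w x] nonincreasing. *)
  assert (wpos : 0 < w x).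
  { destruct (Rle_dec x0 x) as [Hx|Hx].
    - assert (H : exp x0 * w x0 <= exp x * w x).
      { apply (is_derive_nonneg_incr (fun y => exp y * w y)
                 (fun y => exp y * (w y + v y))); trivial.
        - intros y _. auto_derive.
          + eexists; apply Dw.
          + rewrite_Derive (Dw y). ring.
        - intros y _. pose proof (exp_pos y). specialize (Hvw y).
          apply Rabs_le_between in Hvw. nra. }
      pose proof (exp_pos x0). pose proof (exp_pos x). nra.
    - assert (H : exp (- x0) * w x0 <= exp (- x) * w x).
      { apply (is_derive_nonpos_decr (fun y => exp (- y) * w y)
                 (fun y => exp (- y) * (v y - w y))); try lra.
        - intros y _. auto_derive.
          + eexists; apply Dw.
          + rewrite_Derive (Dw y). ring.
        - intros y _. pose proof (exp_pos (- y)). specialize (Hvw y).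
          apply Rabs_le_between in Hvw. nra. }
      pose proof (exp_pos (- x0)). pose proof (exp_pos (- x)). nra. }
  (* [2 * c - phi x] is positive, so [phi x] has the sign of [w x]. *)
  specialize (Hw x). specialize (Hle x). nra.
Qed.

(** From [c^2 - 3 w = (c - phi)^2] and [phi <= c], [phi = c - sqrt (c^2 - 3 w)], which is
    differentiable where the radicand is positive. *)
Lemma steady_DP_derivative (c : R) (phi w v : R -> R) (x : R) :
  (forall y, phi y <= c) -> is_derive w x (v x) ->
  (forall y, 3 * w y = phi y * (2 * c - phi y)) ->
  phi x < c -> is_derive phi x (3 * v x / (2 * (c - phi x))).
Proof.
  intros Hle Dw Hw Hx.
  assert (Hs : forall y, c - sqrt (c ^ 2 - 3 * w y) = phi y).
  { intros y. rewrite (sqrt_lem_1 _ (c - phi y)).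
    - ring.
    - rewrite Hw. specialize (Hle y). nra.
    - specialize (Hle y). lra.
    - rewrite Hw. ring. }
  apply (is_derive_ext _ _ _ _ Hs).
  auto_derive.
  - repeat split; [now exists (v x)|]. rewrite Hw. nra.
  - rewrite_Derive Dw.
    replace (sqrt _) with (c - phi x)
      by (rewrite <- (Hs x) at 1; ring_simplify; f_equal; ring).
    field. lra.
Qed.

(** The difference of the two sides has derivative zero and is dominated by [c^2 * phi^2], which
    tends to zero at infinity. *)
Lemma steady_DP_first_integral (c : R) (phi w v : R -> R) :
  0 < c -> (forall x, continuity_pt phi x) -> is_lim phi p_infty 0 ->
  (forall x, phi x <= c) ->
  (forall x, is_derive w x (v x)) ->
  (forall x, is_derive v x (w x - phi x ^ 2)) ->
  (forall x, 3 * w x = phi x * (2 * c - phi x)) ->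
  (forall x, Rabs (v x) <= w x) ->
  forall x, v x ^ 2 = 4 / 9 * (phi x ^ 2 * (c - phi x) ^ 2).
Proof.
  intros hc Cphi Lp Hle Dw Dv Hw Hvw.
  (* [(c - phi)^3] is differentiable even where [phi = c] (and [c - phi] need not be). *)
  assert (HC : exists C : R -> R, (forall y, C y = (c ^ 2 - 3 * w y) * (c - phi y)) /\
            forall x, is_derive C x (- (9 / 2) * (c - phi x) * v x)).
  { eexists; split; [reflexivity|]. intros x.
    destruct (Rle_lt_or_eq_dec _ _ (Hle x)) as [Hx|Hx].
    - pose proof (steady_DP_derivative c phi w v x Hle (Dw x) Hw Hx) as Dp.
      auto_derive.
      + repeat split; eexists; [apply Dw | apply Dp].
      + rewrite_Derive (Dw x); rewrite_Derive Dp.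
        rewrite Hw. field. lra.
    (* Both expressions vanish here; the second has the shape produced by the product rule for a
       vanishing factor. *)
    - replace (- (9 / 2) * (c - phi x) * v x) with (- 3 * v x * (c - phi x))
        by (rewrite Hx; ring).
      apply (is_derive_mult_vanishing (fun y => c ^ 2 - 3 * w y) (fun y => c - phi y)).
      + auto_derive.
        * eexists; apply Dw.
        * rewrite_Derive (Dw x). ring.
      + rewrite Hw, Hx. ring.
      + apply continuity_pt_minus; [|apply Cphi].
        apply continuity_pt_const. intros ? ?. reflexivity. }
  destruct HC as [C [EC Dcube]].
  set (u := fun y => c ^ 2 - 3 * w y).
  (* With [s = c - phi], [u = s^2] and [C = s^3], this expands [phi^2 * s^2 = (c - s)^2 * s^2]. *)
  set (H := fun y => v y ^ 2 - 4 / 9 * (c ^ 2 * u y + u y ^ 2 - 2 * c * C y)).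
  assert (DH : forall x, is_derive H x 0).
  { intros x. unfold H, u. auto_derive.
    - repeat split; eexists; [apply Dv | apply Dw | apply Dw | apply Dcube].
    - rewrite_Derive (Dw x); rewrite_Derive (Dv x); rewrite_Derive (Dcube x).
      replace (w x) with (phi x * (2 * c - phi x) / 3) by (rewrite <- Hw; field).
      field. }
  assert (Hexp : forall x, H x = v x ^ 2 - 4 / 9 * (phi x ^ 2 * (c - phi x) ^ 2)).
  { intros x. unfold H, u. rewrite EC, Hw. field. }
  assert (Hconst : forall x y, x <= y -> H x = H y).
  { intros x y Hxy. apply is_derive_0_open_interval_eq; trivial.
    intros z _. apply (is_derive_continuity_pt H z 0), DH. }
  intros x. apply Rminus_diag_uniq. rewrite <- Hexp.
  (* [H] is a difference of two terms that both lie between [0] and [c^2 * phi^2]. *)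
  assert (Hsmall : forall y, Rabs (H y) <= c ^ 2 * phi y ^ 2).
  { intros y. rewrite Hexp.
    pose proof (Rle_trans _ _ _ (Rabs_pos _) (Hvw y)) as Hwy.
    specialize (Hw y). specialize (Hle y). specialize (Hvw y).
    assert (Hp : 0 <= phi y) by nra.
    assert (H1 : Rabs (v y) <= c * phi y) by nra.
    assert (H2 : v y ^ 2 <= (c * phi y) ^ 2).
    { rewrite <- (pow2_abs (v y)). apply pow_incr. split; [apply Rabs_pos | trivial]. }
    assert (H3 : (phi y * (c - phi y)) ^ 2 <= (c * phi y) ^ 2) by (apply pow_incr; nra).
    rewrite Rpow_mult_distr in H2, H3. rewrite Rpow_mult_distr in H3.
    pose proof (pow2_ge_0 (v y)). pose proof (pow2_ge_0 (phi y * (c - phi y))) as H4.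
    rewrite Rpow_mult_distr in H4.
    apply Rabs_le. lra. }
  destruct (Req_dec (H x) 0) as [|Hne]; [trivial|exfalso].
  apply Rabs_pos_lt in Hne.
  assert (Hc2 : 0 < c ^ 2) by nra.
  (* The cap [1] gives [p^2 <= p < e] for [p = |phi y|], so that [c^2 * p^2 < |H x|], against
     [Hsmall]. *)
  destruct (is_lim_0_p_infty_bound phi (Rmin 1 (Rabs (H x) / c ^ 2)) Lp) as [A HA].
  { apply Rmin_pos; [lra | now apply Rdiv_lt_0_compat]. }
  set (y := Rmax x A + 1).
  pose proof (Rmax_l x A). pose proof (Rmax_r x A).
  specialize (HA y ltac:(unfold y; lra)).
  specialize (Hsmall y). rewrite <- (Hconst x y) in Hsmall by (unfold y; lra).
  rewrite <- (pow2_abs (phi y)) in Hsmall.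
  pose proof (Rmin_l 1 (Rabs (H x) / c ^ 2)). pose proof (Rmin_r 1 (Rabs (H x) / c ^ 2)).
  pose proof (Rabs_pos (phi y)) as Hp.
  assert (E : Rabs (H x) = c ^ 2 * (Rabs (H x) / c ^ 2)) by (field; lra).
  set (e := Rabs (H x) / c ^ 2) in *. set (p := Rabs (phi y)) in *.
  assert (p ^ 2 < e) by nra.
  assert (c ^ 2 * p ^ 2 < c ^ 2 * e) by (apply Rmult_lt_compat_l; trivial).
  lra.
Qed.

(** * Existence and uniqueness of the point of height [c] *)

Lemma highest_wave_attains (c : R) (phi : R -> R) :
  0 < c -> (forall x, continuity_pt phi x) ->
  is_lim phi p_infty 0 -> is_lim phi m_infty 0 -> is_highest c phi ->
  exists x0, phi x0 = c.
Proof.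
  intros hc Cphi Lp Lm [Hub Hlub].
  destruct (Classical_Prop.classic (exists a, 0 < phi a)) as [[a Ha]|Hn].
  - destruct (vanishing_at_infinity_attains_max phi a Cphi Lp Lm Ha) as [x0 Hx0].
    exists x0. apply Rle_antisym.
    + apply Hub. now exists x0.
    + apply Hlub. intros y [x ->]. apply Hx0.
  - exfalso. assert (c <= 0); [|lra].
    apply Hlub. intros y [x ->]. apply Rnot_lt_le. intros H. apply Hn. now exists x.
Qed.

(** Between two such points [phi] has an interior minimum, below [c]. As [t * (2 * c - t)] increases
    for [t <= c], it is also a minimum of [w], so [v = 0] there, whereas the first integral is
    nonzero for [0 < phi < c]. *)
Lemma full_height_point_unique (c : R) (phi w v : R -> R) :
  (forall x, continuity_pt phi x) -> (forall x, phi x <= c) ->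
  (forall x, is_derive w x (v x)) ->
  (forall x, 3 * w x = phi x * (2 * c - phi x)) ->
  (forall x, v x ^ 2 = 4 / 9 * (phi x ^ 2 * (c - phi x) ^ 2)) ->
  (forall x, 0 < phi x) ->
  (forall x, phi x = c -> exists d, 0 < d /\ forall y, x < y < x + d -> phi y < c) ->
  forall a b, phi a = c -> phi b = c -> a < b -> False.
Proof.
  intros Cphi Hle Dw Hw Hv Hpos Hiso a b Ha Hb Hab.
  destruct (Hiso a Ha) as [d [Hd Hlt]].
  set (z := a + Rmin d (b - a) / 2).
  assert (Hz : a < z < b /\ z < a + d).
  { unfold z. pose proof (Rmin_l d (b - a)). pose proof (Rmin_r d (b - a)).
    pose proof (Rmin_pos d (b - a) Hd). lra. }
  assert (Hphiz : phi z < c) by (apply Hlt; lra).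
  destruct (continuity_ab_min phi a b) as [m [Hm Hmab]]; [lra | intros; apply Cphi|].
  assert (Hphim : phi m < c) by (specialize (Hm z); lra).
  assert (m <> a) by (intros ->; lra).
  assert (m <> b) by (intros ->; lra).
  assert (Dm : derivable_pt_lim w m (v m)) by apply is_derive_Reals, Dw.
  assert (vm : v m = 0).
  { apply (deriv_minimum w a b m (exist _ (v m) Dm)); try lra.
    intros y Hy1 Hy2.
    pose proof (Hw m). pose proof (Hw y). pose proof (Hle y).
    specialize (Hm y ltac:(lra)). nra. }
  specialize (Hv m). rewrite vm in Hv. specialize (Hpos m).
  assert (0 < phi m * (c - phi m)) by nra. nra.
Qed.

(** * Symmetry, location of the crest and strict monotonicity *)

Theorem theorem3p4 (c : R) (phi : R -> R)
  (hc : 0 < c)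
  (hphi : continuous_solitary_solution c phi)
  (hhigh : is_highest c phi)
  (hloc : forall x0 : R, phi x0 = c ->
    exists alpha C1 C2 : R,
      0 < alpha <= 1 /\ 0 < C1 /\ 0 < C2 /\
      locally x0 (fun x =>
        C1 * rpow (Rabs (x - x0)) alpha <= c - phi x
          <= C2 * rpow (Rabs (x - x0)) alpha)) :
  exists lambda0 : R,
    symmetric_about phi lambda0 /\
    (phi lambda0 = c /\ forall x : R, crest phi x <-> x = lambda0) /\
    (forall x y : R, x < y -> y <= lambda0 -> phi x < phi y) /\
    (forall x y : R, lambda0 <= x -> x < y -> phi y < phi x).
Proof.
  pose proof hphi as [Cphi' [Lp [Lm _]]].
  assert (Cphi : forall x, continuity_pt phi x)
    by (intros x; apply continuity_pt_filterlim, Cphi').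
  assert (Hle : forall x, phi x <= c) by (intros x; apply hhigh; now exists x).
  destruct (highest_wave_attains c phi hc Cphi Lp Lm hhigh) as [x0 H0].
  destruct (steady_DP_reduction c phi hc hphi Hle (ex_intro _ x0 H0))
    as [w [v [Dw [Dv [Hw [Hvw Hpos]]]]]].
  pose proof (steady_DP_first_integral c phi w v hc Cphi Lp Hle Dw Dv Hw Hvw) as Hv.
  (* The lower bound [C1 * |y - x|^alpha] on [c - phi y] is positive just right of [x]. *)
  assert (Hiso : forall x, phi x = c ->
            exists d, 0 < d /\ forall y, x < y < x + d -> phi y < c).
  { intros x Hx. destruct (hloc x Hx) as [al [C1 [C2 [_ [HC1 [_ [d Hd]]]]]]].
    exists d. split; [apply cond_pos|]. intros y Hy.
    destruct (Hd y) as [H _].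
    - apply Rabs_def1; unfold minus, plus, opp; simpl; lra.
    - assert (0 < rpow (Rabs (y - x)) al).
      { unfold rpow. rewrite Rabs_pos_eq by lra.
        destruct (Req_EM_T (y - x) 0); [lra | apply exp_pos]. }
      nra. }
  pose proof (full_height_point_unique c phi w v Cphi Hle Dw Hw Hv Hpos Hiso) as Huniq.
  assert (Hlt : forall x, x <> x0 -> phi x < c).
  { intros x Hx. destruct (Rle_lt_or_eq_dec _ _ (Hle x)) as [|E]; trivial. exfalso.
    destruct (Rdichotomy x x0 Hx); eauto. }
  assert (Hphi : forall x, phi x = c * exp (- Rabs (x - x0))).
  { apply (peakon_profile c x0 phi w v); trivial.
    - intros x. apply (is_derive_continuity_pt v x _ (Dv x)).
    - intros x. now apply steady_DP_derivative with w. }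
  assert (Hincr : forall x y, x < y -> y <= x0 -> phi x < phi y).
  { intros x y Hxy Hy. rewrite !Hphi. apply Rmult_lt_compat_l, exp_increasing; trivial.
    rewrite !Rabs_left1 by lra. lra. }
  assert (Hdecr : forall x y, x0 <= x -> x < y -> phi y < phi x).
  { intros x y Hx Hxy. rewrite !Hphi. apply Rmult_lt_compat_l, exp_increasing; trivial.
    rewrite !Rabs_pos_eq by lra. lra. }
  exists x0. split; [|split; [split; [exact H0|intros x; split]|now split]].
  - intros x. rewrite !Hphi. rewrite <- (Rabs_Ropp (x - x0)).
    now replace (- (x - x0)) with (2 * x0 - x - x0) by ring.
  (* From a crest other than [x0], a step [h] towards [x0], short enough to stay in the
     neighbourhood and not pass [x0], strictly increases [phi]. *)
  - intros [d Hd]. destruct (Rtotal_order x x0) as [Hx|[Hx|Hx]]; trivial; exfalso.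
    + set (h := Rmin d (x0 - x) / 2).
      pose proof (Rmin_l d (x0 - x)). pose proof (Rmin_r d (x0 - x)).
      pose proof (Rmin_pos d (x0 - x) (cond_pos d)).
      assert (phi (x + h) <= phi x).
      { apply Hd. apply Rabs_def1; unfold h, minus, plus, opp; simpl; lra. }
      assert (phi x < phi (x + h)) by (apply Hincr; unfold h; lra). lra.
    + set (h := Rmin d (x - x0) / 2).
      pose proof (Rmin_l d (x - x0)). pose proof (Rmin_r d (x - x0)).
      pose proof (Rmin_pos d (x - x0) (cond_pos d)).
      assert (phi (x - h) <= phi x).
      { apply Hd. apply Rabs_def1; unfold h, minus, plus, opp; simpl; lra. }
      assert (phi x < phi (x - h)) by (apply Hdecr; unfold h; lra). lra.
  - intros ->. exists (mkposreal 1 Rlt_0_1). intros y _. rewrite H0. apply Hle.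
Qed.
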